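(* Consider a connected first order circuit with a chosen reference node, and its time-invariant nodal model, i.e. the semiexplicit differential-algebraic system in the dynamic variables $x=(q_c,q_{mc},\varphi_l,\varphi_{ml},q_m,q_{ml},q_{hm},q_{hw},\varphi_w,\varphi_{mc},\varphi_{hm},\varphi_{hw})$ and the algebraic variables $y=(e,i_c,i_{mc},i_u,i_l,i_{ml},i_r,i_m,i_{hm},i_{hw})$ written out in the context. Assume that the (incremental) capacitance matrix $C$, memcapacitance matrix $C_{\mathrm m}$, inductance matrix $L$ and meminductance matrix $L_{\mathrm m}$ are non-singular, and that the (incremental) resistance matrix $R$, conductance matrix $G$, memristance matrix $M$, hybrid memristance matrix $M_{\mathrm h}$, memductance matrix $W$ and hybrid memductance matrix $W_{\mathrm h}$ are positive definite (not necessarily symmetric), at all values of their arguments. Then, around any point $(x^*,y^*,t^* )$ satisfying the algebraic equations of the nodal model, the nodal model is index one if and only if the circuit is topologically nondegenerate, that is, if and only if the circuit contains neither loops composed only of voltage sources, capacitors and/or memcapacitors, nor cutsets composed only of current sources, inductors and/or meminductors.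
   Context: **Circuit and incidence matrix.** A circuit is a connected directed graph whose branches are the devices; a reference node is chosen. The reduced incidence matrix $A=(a_{kj})$ has one row per non-reference node and one column per branch, with $a_{kj}=1$ if branch $j$ leaves node $k$, $a_{kj}=-1$ if branch $j$ enters node $k$, and $a_{kj}=0$ if branch $j$ is not incident with node $k$. Branch currents $i$ and voltages $v$ satisfy Kirchhoff's laws $Ai=0$, $v=A^Te$, where $e$ is the vector of node potentials. The columns of $A$ are partitioned according to device type, giving submatrices $A_c,A_l,A_r,A_g,A_m,A_w,A_{mc},A_{ml},A_{hm},A_{hw},A_u,A_j$, and vectors of variables carry the same subscripts. Every branch of the circuit belongs to one of these types (any type may be absent). **Devices** ($q$ = charge, $\varphi$ = flux; $q'=i$ and $\varphi'=v$ for each branch). All maps below are $C^1$ and time-invariant, defined on the whole corresponding real spaces, and vector-valued (one map for all the devices of a given type, so full coupling within each type is allowed): - $c$: capacitors, $q_c=\gamma_c(v_c)$; - $l$: inductors, $\varphi_l=\gamma_l(i_l)$; - $r$: current-controlled resistors, $v_r=\gamma_r(i_r)$; - $g$: voltage-controlled resistors, $i_g=\gamma_g(v_g)$; - $m$: $q$-memristors, $v_m=\eta(q_m,i_m)$; - $w$: $\varphi$-memristors, $i_w=\zeta(\varphi_w,v_w)$; - $mc$: voltage-controlled memcapacitors, $q_{mc}=\omega(\varphi_{mc},v_{mc})$; - $ml$: current-controlled meminductors, $\varphi_{ml}=\theta(q_{ml},i_{ml})$; - $hm$: current-controlled hybrid memristors, $v_{hm}=\psi(q_{hm},\varphi_{hm},i_{hm})$;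 - $hw$: voltage-controlled hybrid memristors, $i_{hw}=\xi(q_{hw},\varphi_{hw},v_{hw})$; - $u$: voltage sources, $v_u=v_s(t)$; - $j$: current sources, $i_j=i_s(t)$, with $v_s,i_s$ of class $C^1$. By definition of these devices, none of the partial derivatives of the scalar maps $\eta,\zeta,\omega,\theta,\psi,\xi$ with respect to each of its arguments vanishes identically (for coupled devices this requirement is replaced by non-singularity of the corresponding matrices of partial derivatives). **Incremental matrices.** $R=\gamma_r'$, $G=\gamma_g'$, $C=\gamma_c'$, $L=\gamma_l'$, $M=\partial\eta/\partial i_m$, $W=\partial\zeta/\partial v_w$, $C_{\mathrm m}=\partial\omega/\partial v_{mc}$, $L_{\mathrm m}=\partial\theta/\partial i_{ml}$, $M_{\mathrm h}=\partial\psi/\partial i_{hm}$, $W_{\mathrm h}=\partial\xi/\partial v_{hw}$. They need not be diagonal or symmetric. A square real matrix $K$ is positive definite if $u^TKu>0$ for every nonzero real vector $u$; symmetry is not required. **Nodal model.** The differential equations are $$q_c'=i_c,\quad q_{mc}'=i_{mc},\quad \varphi_l'=A_l^Te,\quad \varphi_{ml}'=A_{ml}^Te,\quad q_m'=i_m,\quad q_{ml}'=i_{ml},$$ $$q_{hm}'=i_{hm},\quad q_{hw}'=i_{hw},\quad \varphi_w'=A_w^Te,\quad \varphi_{mc}'=A_{mc}^Te,\quad \varphi_{hm}'=A_{hm}^Te,\quad \varphi_{hw}'=A_{hw}^Te,$$ and the algebraic equations are $$0=A_ci_c+A_{mc}i_{mc}+A_ui_u+A_li_l+A_{ml}i_{ml}+A_g\gamma_g(A_g^Te)+A_w\zeta(\varphi_w,A_w^Te)+A_ri_r+A_mi_m+A_{hm}i_{hm}+A_{hw}i_{hw}+A_ji_s(t),$$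 $$0=q_c-\gamma_c(A_c^Te),\quad 0=q_{mc}-\omega(\varphi_{mc},A_{mc}^Te),\quad 0=v_s(t)-A_u^Te,\quad 0=\varphi_l-\gamma_l(i_l),\quad 0=\varphi_{ml}-\theta(q_{ml},i_{ml}),$$ $$0=\gamma_r(i_r)-A_r^Te,\quad 0=\eta(q_m,i_m)-A_m^Te,\quad 0=\psi(q_{hm},\varphi_{hm},i_{hm})-A_{hm}^Te,\quad 0=i_{hw}-\xi(q_{hw},\varphi_{hw},A_{hw}^Te).$$ **Index one.** A semiexplicit differential-algebraic equation $x'=f(x,y,t)$, $0=g(x,y,t)$ with $f\in C^1(\mathbb{R}^{r+p+1},\mathbb{R}^r)$, $g\in C^1(\mathbb{R}^{r+p+1},\mathbb{R}^p)$, $x\in\mathbb{R}^r$, $y\in\mathbb{R}^p$, is index one around a point $(x^*,y^*,t^* )$ with $g(x^*,y^*,t^* )=0$ if the matrix of partial derivatives $g_y(x^*,y^*,t^* )$ is invertible. **Topologically nondegenerate.** A first order circuit is topologically nondegenerate if it displays neither loops defined by voltage sources, capacitors and/or memcapacitors, nor cutsets composed of current sources, inductors and/or meminductors. (Loops are cycles of the graph, ignoring orientation; cutsets are minimal sets of branches whose removal disconnects the connected graph.) *)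

(* Defs.v *)
(* MathComp / MathComp-Analysis. *)
From HB Require Import structures.
From mathcomp Require Import all_boot all_order all_algebra.
From mathcomp Require Import boolp classical_sets reals topology normedtype derive.

Set Implicit Arguments.
Unset Strict Implicit.
Unset Printing Implicit Defensive.

Import Order.TTheory GRing.Theory Num.Theory.
Import numFieldNormedType.Exports.
Local Open Scope ring_scope.

(* In finite dimension, continuity of x |-> 'D_v f x for every fixed v is
   continuity of the differential; all spaces used below are products of 'cV's
   and R. *)
Definition C1 (R : realType) (V W : normedModType R) (f : V -> W) : Prop :=
  (forall x, differentiable f x) /\ (forall v, continuous (fun x => 'D_v f x)).

(* Entry (i, j) is the partial derivative of the i-th component of f with
   respect to the j-th variable.  This is the transpose of the library's
   [jacobian], which acts on row vectors from the right. *)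
Definition partials (R : realType) (m n : nat) (f : 'cV[R]_n -> 'cV[R]_m)
    (x : 'cV[R]_n) : 'M[R]_(m, n) :=
  \matrix_(i, j) ('D_(delta_mx j 0) f x) i 0.

Definition posdef (R : realType) (n : nat) (K : 'M[R]_n) : Prop :=
  forall u : 'cV[R]_n, u != 0 -> 0 < (u^T *m K *m u) 0 0.

(* x' = dae_f x y t, 0 = dae_g x y t.  Smoothness is not bundled: for the nodal
   model below, f and g are C^1 because all the device maps are. *)
Record semiexplicit_dae (R : realType) (r p : nat) := SemiexplicitDAE {
  dae_f : 'cV[R]_r -> 'cV[R]_p -> R -> 'cV[R]_r;
  dae_g : 'cV[R]_r -> 'cV[R]_p -> R -> 'cV[R]_p
}.

Definition index_one (R : realType) (r p : nat) (S : semiexplicit_dae R r p)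
    (x : 'cV[R]_r) (y : 'cV[R]_p) (t : R) : Prop :=
  dae_g S x y t = 0 /\ partials (fun y' => dae_g S x y' t) y \in unitmx.

Inductive device :=
  | kc   (* capacitor *)
  | kl   (* inductor *)
  | kr   (* current-controlled resistor *)
  | kg   (* voltage-controlled resistor *)
  | km   (* q-memristor *)
  | kw   (* phi-memristor *)
  | kmc  (* voltage-controlled memcapacitor *)
  | kml  (* current-controlled meminductor *)
  | khm  (* current-controlled hybrid memristor *)
  | khw  (* voltage-controlled hybrid memristor *)
  | ku   (* voltage source *)
  | kj.  (* current source *)

Definition device_code (k : device) : 'I_12 :=
  match k with
  | kc => @Ordinal 12 0 isT  | kl => @Ordinal 12 1 isT
  | kr => @Ordinal 12 2 isT  | kg => @Ordinal 12 3 isT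
  | km => @Ordinal 12 4 isT  | kw => @Ordinal 12 5 isT
  | kmc => @Ordinal 12 6 isT | kml => @Ordinal 12 7 isT
  | khm => @Ordinal 12 8 isT | khw => @Ordinal 12 9 isT
  | ku => @Ordinal 12 10 isT | kj => @Ordinal 12 11 isT
  end.

Definition device_decode (i : 'I_12) : device :=
  nth kc [:: kc; kl; kr; kg; km; kw; kmc; kml; khm; khw; ku; kj] i.

Lemma device_codeK : cancel device_code device_decode.
Proof. by case. Qed.

HB.instance Definition _ := Finite.copy device (can_type device_codeK).

(* Branches are grouped by device type: branch (k, j) is the j-th device of
   type k. *)
Notation branch_of nb := {k : device & 'I_(nb k)}.

(* Branch b leaves source b and enters target b; parallel branches and
   self-loops are allowed. *)
Record digraph := Digraph {
  nn : nat;                (* number of non-reference nodes *)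
  nb : device -> nat;      (* number of branches of each type *)
  source : branch_of nb -> 'I_nn.+1;
  target : branch_of nb -> 'I_nn.+1;
  refnode : 'I_nn.+1
}.

Notation node N := 'I_(nn N).+1.
Notation branch N := (branch_of (nb N)).

Section Graph.
Variable N : digraph.
Implicit Types (b : branch N) (u v : node N) (S K : {set branch N}).

Definition joins b u v : bool :=
  ((source b == u) && (target b == v)) || ((source b == v) && (target b == u)).

Definition connected_by S : bool :=
  [forall u : node N, forall v : node N,
     connect (fun u' v' : node N => [exists b in S, joins b u' v']) u v].

Definition connected_graph : bool := connected_by [set: branch N].

(* s lists the pairs (v_i, b_i) of the cycle v_0 b_0 v_1 b_1 ... b_(n-1) v_0.
   Self-loops (n = 1) and pairs of parallel branches (n = 2) are loops. *)
Definition loop (s : seq (node N * branch N)) : bool :=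
  [&& s != [::], uniq (map fst s), uniq (map snd s) &
      path.cycle (fun p q => joins p.2 p.1 q.1) s].

Definition cutset K : bool :=
  minset (fun K' : {set branch N} => ~~ connected_by (~: K')) K.

Definition topologically_nondegenerate : Prop :=
  (forall s, loop s ->
     ~~ all (fun p : node N * branch N => tag p.2 \in [:: ku; kc; kmc]) s) /\
  (forall K, cutset K ->
     ~~ [forall b in K, tag b \in [:: kj; kl; kml]]).

(* Columns of type k of the reduced incidence matrix.  A self-loop leaves and
   enters the same node, and gets a zero column. *)
Definition incidence (R : realType) (k : device) : 'M[R]_(nn N, nb N k) :=
  \matrix_(i, j)
    let b : branch N := Tagged (fun k' : device => 'I_(nb N k')) j in
    let v : node N := lift (refnode N) i in
    (source b == v)%:R - (target b == v)%:R.

End Graph.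

(* The fields *_genuine say that the memory devices depend on each of their
   arguments.  For a single (scalar) device, and for any family of uncoupled
   ones, "some matrix of partial derivatives is nonsingular" is exactly "no
   partial derivative vanishes identically"; for coupled devices it is the
   weakest form of the nonsingularity requirement. *)
Record circuit (R : realType) := Circuit {
  graph :> digraph;

  gamma_c : 'cV[R]_(nb graph kc) -> 'cV[R]_(nb graph kc);
  gamma_l : 'cV[R]_(nb graph kl) -> 'cV[R]_(nb graph kl);
  gamma_r : 'cV[R]_(nb graph kr) -> 'cV[R]_(nb graph kr);
  gamma_g : 'cV[R]_(nb graph kg) -> 'cV[R]_(nb graph kg);
  eta : 'cV[R]_(nb graph km) -> 'cV[R]_(nb graph km) -> 'cV[R]_(nb graph km);
  zeta : 'cV[R]_(nb graph kw) -> 'cV[R]_(nb graph kw) -> 'cV[R]_(nb graph kw);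
  omega : 'cV[R]_(nb graph kmc) -> 'cV[R]_(nb graph kmc) ->
    'cV[R]_(nb graph kmc);
  theta : 'cV[R]_(nb graph kml) -> 'cV[R]_(nb graph kml) ->
    'cV[R]_(nb graph kml);
  psi : 'cV[R]_(nb graph khm) -> 'cV[R]_(nb graph khm) ->
    'cV[R]_(nb graph khm) -> 'cV[R]_(nb graph khm);
  xi : 'cV[R]_(nb graph khw) -> 'cV[R]_(nb graph khw) ->
    'cV[R]_(nb graph khw) -> 'cV[R]_(nb graph khw);
  v_s : R -> 'cV[R]_(nb graph ku);
  i_s : R -> 'cV[R]_(nb graph kj);

  gamma_c_C1 : C1 gamma_c;
  gamma_l_C1 : C1 gamma_l;
  gamma_r_C1 : C1 gamma_r;
  gamma_g_C1 : C1 gamma_g;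
  eta_C1 : C1 (fun a => eta a.1 a.2);
  zeta_C1 : C1 (fun a => zeta a.1 a.2);
  omega_C1 : C1 (fun a => omega a.1 a.2);
  theta_C1 : C1 (fun a => theta a.1 a.2);
  psi_C1 : C1 (fun a => psi a.1.1 a.1.2 a.2);
  xi_C1 : C1 (fun a => xi a.1.1 a.1.2 a.2);
  v_s_C1 : C1 v_s;
  i_s_C1 : C1 i_s;

  eta_genuine :
    (exists q i, partials (fun q' => eta q' i) q \in unitmx) /\
    (exists q i, partials (fun i' => eta q i') i \in unitmx);
  zeta_genuine :
    (exists phi v, partials (fun phi' => zeta phi' v) phi \in unitmx) /\
    (exists phi v, partials (fun v' => zeta phi v') v \in unitmx);
  omega_genuine :
    (exists phi v, partials (fun phi' => omega phi' v) phi \in unitmx) /\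
    (exists phi v, partials (fun v' => omega phi v') v \in unitmx);
  theta_genuine :
    (exists q i, partials (fun q' => theta q' i) q \in unitmx) /\
    (exists q i, partials (fun i' => theta q i') i \in unitmx);
  psi_genuine :
    [/\ exists q phi i, partials (fun q' => psi q' phi i) q \in unitmx,
        exists q phi i, partials (fun phi' => psi q phi' i) phi \in unitmx &
        exists q phi i, partials (fun i' => psi q phi i') i \in unitmx];
  xi_genuine :
    [/\ exists q phi v, partials (fun q' => xi q' phi v) q \in unitmx,
        exists q phi v, partials (fun phi' => xi q phi' v) phi \in unitmx &
        exists q phi v, partials (fun v' => xi q phi v') v \in unitmx]
}.

Section Incremental.
Variables (R : realType) (N : circuit R).

Definition capacitance v := partials (@gamma_c R N) v.
Definition inductance i := partials (@gamma_l R N) i.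
Definition resistance i := partials (@gamma_r R N) i.
Definition conductance v := partials (@gamma_g R N) v.
Definition memristance q i := partials (fun i' => @eta R N q i') i.
Definition memductance phi v := partials (fun v' => @zeta R N phi v') v.
Definition memcapacitance phi v := partials (fun v' => @omega R N phi v') v.
Definition meminductance q i := partials (fun i' => @theta R N q i') i.
Definition hybrid_memristance q phi i :=
  partials (fun i' => @psi R N q phi i') i.
Definition hybrid_memductance q phi v :=
  partials (fun v' => @xi R N q phi v') v.

End Incremental.

Arguments capacitance {R} N v.
Arguments inductance {R} N i.
Arguments resistance {R} N i.
Arguments conductance {R} N v.
Arguments memristance {R} N q i.
Arguments memductance {R} N phi v.
Arguments memcapacitance {R} N phi v.
Arguments meminductance {R} N q i.
Arguments hybrid_memristance {R} N q phi i.
Arguments hybrid_memductance {R} N q phi v.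

Section NodalModel.
Variables (R : realType) (N : circuit R).
Local Notation n k := (nb N k).
Local Notation A k := (incidence N R k).

(* x = (q_c, q_mc, phi_l, phi_ml, q_m, q_ml, q_hm, q_hw,
        phi_w, phi_mc, phi_hm, phi_hw) *)
Definition dim_x : nat :=
  n kc + (n kmc + (n kl + (n kml + (n km + (n kml + (n khm + (n khw +
  (n kw + (n kmc + (n khm + n khw)))))))))).

(* y = (e, i_c, i_mc, i_u, i_l, i_ml, i_r, i_m, i_hm, i_hw) *)
Definition dim_y : nat :=
  nn N + (n kc + (n kmc + (n ku + (n kl + (n kml + (n kr + (n km +
  (n khm + n khw)))))))).

Definition nodal_f (x : 'cV[R]_dim_x) (y : 'cV[R]_dim_y) (t : R) :
    'cV[R]_dim_x :=
  let e := usubmx y in      let y1 := dsubmx y in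
  let i_c := usubmx y1 in   let y2 := dsubmx y1 in
  let i_mc := usubmx y2 in  let y3 := dsubmx y2 in
  let i_u := usubmx y3 in   let y4 := dsubmx y3 in
  let i_l := usubmx y4 in   let y5 := dsubmx y4 in
  let i_ml := usubmx y5 in  let y6 := dsubmx y5 in
  let i_r := usubmx y6 in   let y7 := dsubmx y6 in
  let i_m := usubmx y7 in   let y8 := dsubmx y7 in
  let i_hm := usubmx y8 in  let i_hw := dsubmx y8 in
  col_mx (* q_c' *)    i_c (
  col_mx (* q_mc' *)   i_mc (
  col_mx (* phi_l' *)  ((A kl)^T *m e) (
  col_mx (* phi_ml' *) ((A kml)^T *m e) (
  col_mx (* q_m' *)    i_m (
  col_mx (* q_ml' *)   i_ml (
  col_mx (* q_hm' *)   i_hm (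
  col_mx (* q_hw' *)   i_hw (
  col_mx (* phi_w' *)  ((A kw)^T *m e) (
  col_mx (* phi_mc' *) ((A kmc)^T *m e) (
  col_mx (* phi_hm' *) ((A khm)^T *m e)
         (* phi_hw' *) ((A khw)^T *m e))))))))))).

Definition nodal_g (x : 'cV[R]_dim_x) (y : 'cV[R]_dim_y) (t : R) :
    'cV[R]_dim_y :=
  let q_c := usubmx x in      let x1 := dsubmx x in
  let q_mc := usubmx x1 in    let x2 := dsubmx x1 in
  let phi_l := usubmx x2 in   let x3 := dsubmx x2 in
  let phi_ml := usubmx x3 in  let x4 := dsubmx x3 in
  let q_m := usubmx x4 in     let x5 := dsubmx x4 in
  let q_ml := usubmx x5 in    let x6 := dsubmx x5 in
  let q_hm := usubmx x6 in    let x7 := dsubmx x6 in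
  let q_hw := usubmx x7 in    let x8 := dsubmx x7 in
  let phi_w := usubmx x8 in   let x9 := dsubmx x8 in
  let phi_mc := usubmx x9 in  let x10 := dsubmx x9 in
  let phi_hm := usubmx x10 in let phi_hw := dsubmx x10 in
  let e := usubmx y in      let y1 := dsubmx y in
  let i_c := usubmx y1 in   let y2 := dsubmx y1 in
  let i_mc := usubmx y2 in  let y3 := dsubmx y2 in
  let i_u := usubmx y3 in   let y4 := dsubmx y3 in
  let i_l := usubmx y4 in   let y5 := dsubmx y4 in
  let i_ml := usubmx y5 in  let y6 := dsubmx y5 in
  let i_r := usubmx y6 in   let y7 := dsubmx y6 in
  let i_m := usubmx y7 in   let y8 := dsubmx y7 in
  let i_hm := usubmx y8 in  let i_hw := dsubmx y8 in
  col_mx (A kc *m i_c + A kmc *m i_mc + A ku *m i_u + A kl *m i_l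
          + A kml *m i_ml + A kg *m gamma_g ((A kg)^T *m e)
          + A kw *m zeta phi_w ((A kw)^T *m e) + A kr *m i_r
          + A km *m i_m + A khm *m i_hm + A khw *m i_hw
          + A kj *m i_s N t) (
  col_mx (q_c - gamma_c ((A kc)^T *m e)) (
  col_mx (q_mc - omega phi_mc ((A kmc)^T *m e)) (
  col_mx (v_s N t - (A ku)^T *m e) (
  col_mx (phi_l - gamma_l i_l) (
  col_mx (phi_ml - theta q_ml i_ml) (
  col_mx (gamma_r i_r - (A kr)^T *m e) (
  col_mx (eta q_m i_m - (A km)^T *m e) (
  col_mx (psi q_hm phi_hm i_hm - (A khm)^T *m e)
         (i_hw - xi q_hw phi_hw ((A khw)^T *m e)))))))))).

Definition nodal_model : semiexplicit_dae R dim_x dim_y :=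
  SemiexplicitDAE nodal_f nodal_g.

End NodalModel.

(* Main.v *)
Require Import Defs.
From mathcomp Require Import all_boot all_order all_algebra.
From mathcomp Require Import boolp classical_sets functions reals topology.
From mathcomp Require Import normedtype derive.

Set Implicit Arguments.
Unset Strict Implicit.
Unset Printing Implicit Defensive.

Import Order.TTheory GRing.Theory Num.Theory.
Import numFieldNormedType.Exports.
Local Open Scope ring_scope.

(** Index one means that the differential of the algebraic equations with
    respect to [y] has a trivial kernel.  By the chain rule
    ([is_diff_nodal_g]) this differential is the nodal system of a linear
    resistive circuit on the same graph, with the incremental matrices as
    devices ([linearized_g]).

    A kernel element is a solution of that linear circuit.  Nonsingularity
    forces zero voltage on the capacitive branches and zero current in the
    inductive branches; the sources, being prescribed, are set to zero; the
    remaining branches obey Ohm's law with positive definite matrices.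
    By Tellegen's theorem ([tellegen]) the total power vanishes, and it is a sum of nonnegative
    terms, so every resistive branch has zero voltage and zero current.  What is
    left ([linearized_g_eq0]) is a current flow carried by voltage sources,
    capacitors and memcapacitors, together with a node potential that may vary
    only across current sources, inductors and meminductors; the two are
    independent of each other.

    Both residues are topological.  A nonzero conserved current contains a loop
    in its support: follow the current downstream until a node repeats
    ([loop_in_support]); conversely a loop carries a unit circulating current
    ([outflow_loop_flow]).  A nonzero potential, grounded at the reference node,
    that is constant across the branches of a set [S] exists exactly when [S]
    does not connect the graph ([connected_potential],
    [disconnected_potential]), that is, when the complement of [S] contains a
    cutset ([cutset_in]). *)

(** * Differentials between spaces of column vectors *)

Section Differentials.
Variable R : realType.

(** In finite dimension a linear map is a finite sum of coordinates times
    constant vectors. *)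
Lemma differentiable_linear m n (f : {linear 'cV[R]_n -> 'cV[R]_m}) x :
  differentiable f x.
Proof.
have -> : (f : 'cV[R]_n -> 'cV[R]_m) =
    \sum_(j < n) ((fun y => y j 0 *: f (delta_mx j 0)) : 'cV[R]_n -> 'cV[R]_m).
  apply/funext => y; rewrite fct_sumE /= {1}(matrix_sum_delta y) linear_sum.
  by apply: eq_bigr => j _; rewrite big_ord1 linearZ.
apply: differentiable_sum => j; apply: differentiableZl.
exact: differentiable_coord.
Qed.

Lemma is_diff_linear m n (f : {linear 'cV[R]_n -> 'cV[R]_m}) x :
  is_diff x f f.
Proof.
apply: DiffDef; first exact: differentiable_linear.
apply: diff_lin => y.
exact/differentiable_continuous/differentiable_linear.
Qed.

Lemma is_diff_mulmx (V : normedModType R) m n (A : 'M[R]_(m, n))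
    (f df : V -> 'cV[R]_n) x :
  is_diff x f df -> is_diff x (fun y => A *m f y) (fun y => A *m df y).
Proof.
by move=> dfx; apply: (is_diff_comp dfx); apply: (is_diff_linear (mulmx A)).
Qed.

Lemma is_diff_usubmx (V : normedModType R) m n (f df : V -> 'cV[R]_(m + n)) x :
  is_diff x f df -> is_diff x (fun y => usubmx (f y)) (fun y => usubmx (df y)).
Proof.
by move=> dfx; apply: (is_diff_comp dfx); apply: (is_diff_linear usubmx).
Qed.

Lemma is_diff_dsubmx (V : normedModType R) m n (f df : V -> 'cV[R]_(m + n)) x :
  is_diff x f df -> is_diff x (fun y => dsubmx (f y)) (fun y => dsubmx (df y)).
Proof.
by move=> dfx; apply: (is_diff_comp dfx); apply: (is_diff_linear dsubmx).
Qed.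

Lemma is_diff_col_mx (V : normedModType R) m n (f df : V -> 'cV[R]_m)
    (g dg : V -> 'cV[R]_n) x :
  is_diff x f df -> is_diff x g dg ->
  is_diff x (fun y => col_mx (f y) (g y)) (fun y => col_mx (df y) (dg y)).
Proof.
have colE (a : 'cV[R]_m) (b : 'cV[R]_n) :
    col_mx a b = col_mx 1%:M 0 *m a + col_mx 0 1%:M *m b.
  by rewrite !mul_col_mx !mul1mx !mul0mx add_col_mx addr0 add0r.
move=> dfx dgx.
have := is_diffD (is_diff_mulmx (col_mx 1%:M 0) dfx)
                 (is_diff_mulmx (col_mx 0 1%:M) dgx).
by congr (is_diff _ _ _); apply/funext => y; rewrite colE.
Qed.

Lemma is_diff_add (V W : normedModType R) (f df g dg : V -> W) x :
  is_diff x f df -> is_diff x g dg ->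
  is_diff x (fun y => f y + g y) (fun y => df y + dg y).
Proof. exact: is_diffD. Qed.

Lemma is_diff_sub (V W : normedModType R) (f df g dg : V -> W) x :
  is_diff x f df -> is_diff x g dg ->
  is_diff x (fun y => f y - g y) (fun y => df y - dg y).
Proof. exact: is_diffB. Qed.

Lemma is_diff_addc (V W : normedModType R) (f df : V -> W) c x :
  is_diff x f df -> is_diff x (fun y => f y + c) df.
Proof.
by move=> dfx; have := is_diffD dfx (is_diff_cst c x); rewrite addr0.
Qed.

Lemma is_diff_csub (V W : normedModType R) (f df : V -> W) c x :
  is_diff x f df -> is_diff x (fun y => c - f y) (fun y => - df y).
Proof.
by move=> dfx; have := is_diffB (is_diff_cst c x) dfx; rewrite sub0r.
Qed.

(** The matrix of directional derivatives along the basis vectors represents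
    the differential only for a differentiable function; this is where
    differentiability of the device maps is used. *)
Lemma partials_mulmx m n (f : 'cV[R]_n -> 'cV[R]_m) df x z :
  is_diff x f df -> partials f x *m z = df z.
Proof.
move=> dfx; have dx : differentiable f x by [].
have -> : df z = 'd f x z by rewrite diff_val.
rewrite [in RHS](matrix_sum_delta z) linear_sum; apply/colP => i.
rewrite mxE summxE; apply: eq_bigr => j _.
by rewrite big_ord1 linearZ /= !mxE deriveE // mulrC.
Qed.

Lemma is_diff_partials m n (f : 'cV[R]_n -> 'cV[R]_m) x :
  differentiable f x -> is_diff x f (mulmx (partials f x)).
Proof.
move=> dx; apply: DiffDef => //; apply/funext => z; symmetry.
exact: partials_mulmx (differentiableP dx).
Qed.

Lemma is_diff_device m n p (f : 'cV[R]_n -> 'cV[R]_m)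
    (h dh : 'cV[R]_p -> 'cV[R]_n) y :
  differentiable f (h y) -> is_diff y h dh ->
  is_diff y (fun y' => f (h y')) (fun z => partials f (h y) *m dh z).
Proof.
by move=> df dhy; apply: (is_diff_comp dhy); apply: is_diff_partials.
Qed.

(** Freezing the state arguments of a memory device leaves a differentiable
    characteristic in the controlling variable. *)
Lemma differentiable_C1_2 (U V W : normedModType R) (f : U -> V -> W) a b :
  C1 (fun p => f p.1 p.2) -> differentiable (f a) b.
Proof.
case=> df _; exact: (@differentiable_comp _ _ _ _ (fun b' => (a, b'))
  (fun p : U * V => f p.1 p.2)).
Qed.

Lemma differentiable_C1_3 (U U' V W : normedModType R) (f : U -> U' -> V -> W)
    a a' b : C1 (fun p => f p.1.1 p.1.2 p.2) -> differentiable (f a a') b.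
Proof.
exact: (@differentiable_C1_2 (U * U')%type _ _ (fun p => f p.1 p.2) (a, a')).
Qed.

Lemma unitmx_kernelP n (M : 'M[R]_n) :
  M \in unitmx <-> (forall z : 'cV[R]_n, M *m z = 0 -> z = 0).
Proof.
split=> [Mu z Mz|inj]; first by rewrite -(mulKmx Mu z) Mz mulmx0.
rewrite -unitmx_tr -row_free_unit -kermx_eq0; apply/eqP/row_matrixP => i.
apply: trmx_inj; rewrite row0 trmx0; apply: inj; apply: trmx_inj.
by rewrite trmx_mul trmxK trmx0; apply/sub_kermxP/row_sub.
Qed.

End Differentials.

(** * Loops, cutsets and the incidence matrix *)

Section Graph.
Variables (R : realType) (N : digraph).
Implicit Types (b : branch N) (u v w : node N) (S K : {set branch N}).
Implicit Types (i : branch N -> R) (E : node N -> R) (P : pred device).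

(** A self-loop contributes zero, in agreement with its zero incidence
    column. *)
Definition outflow i v : R :=
  \sum_b i b * ((source b == v)%:R - (target b == v)%:R).

Lemma sum_outflow i : \sum_v outflow i v = 0.
Proof.
rewrite exchange_big big1 //= => b _; rewrite -mulr_sumr sumrB.
have one u : \sum_v (u == v)%:R = 1 :> R.
  rewrite (bigD1 u) //= eqxx big1 ?addr0 // => v.
  by rewrite eq_sym => /negPf->.
by rewrite !one subrr mulr0.
Qed.

(** The reduced incidence matrix omits the reference node; Kirchhoff's current
    law there follows from the law at the other nodes. *)
Lemma outflow_refnode i :
  (forall k, outflow i (lift (refnode N) k) = 0) -> forall v, outflow i v = 0.
Proof.
move=> i0; have iref : outflow i (refnode N) = 0.
  rewrite -[RHS](sum_outflow i) (bigD1 (refnode N)) //= big1 ?addr0 // => v.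
  by case: (unliftP (refnode N) v) => [k ->|->]; rewrite ?eqxx.
by move=> v; case: (unliftP (refnode N) v) => [k ->|->].
Qed.

(** Reorienting each branch along its current makes all currents
    nonnegative. *)
Definition upstream i b : node N := if 0 < i b then source b else target b.
Definition downstream i b : node N := if 0 < i b then target b else source b.

Lemma joins_stream i b : joins b (upstream i b) (downstream i b).
Proof.
by rewrite /joins /upstream /downstream; case: ifP; rewrite !eqxx ?orbT.
Qed.

Lemma outflowE i v :
  outflow i v =
  \sum_b `|i b| * ((upstream i b == v)%:R - (downstream i b == v)%:R).
Proof.
apply: eq_bigr => b _; rewrite /upstream /downstream.
case: ltP => [i0|i0]; first by rewrite gtr0_norm.
by rewrite ler0_norm // mulNr -mulrN opprB.
Qed.

(** A current that enters a node must leave it: otherwise the outflow at this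
    node would be a sum of nonpositive terms, one of them negative. *)
Lemma next_branch i b : (forall v, outflow i v = 0) -> i b != 0 ->
  exists2 b', i b' != 0 & upstream i b' = downstream i b.
Proof.
move=> /(_ (downstream i b)) + ib; rewrite outflowE => flow0.
case: (pselect (exists2 b', i b' != 0 & upstream i b' = downstream i b))
  => // none.
move: flow0.
rewrite (eq_bigr (fun b' =>
  - (`|i b'| * (downstream i b' == downstream i b)%:R))).
  move=> /eqP; rewrite sumrN oppr_eq0 psumr_eq0 => [|b' _].
    move=> /allP/(_ b (mem_index_enum _)).
    by rewrite eqxx mulr1 normr_eq0 (negPf ib).
  by rewrite mulr_ge0.
move=> b' _; have [->|ib'] := eqVneq (i b') 0.
  by rewrite normr0 !mul0r oppr0.
have [tb'|_] := eqVneq (upstream i b') (downstream i b).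
  by case: none; exists b'.
by rewrite sub0r mulrN.
Qed.

(** Choosing one outgoing current-carrying branch at each node defines a
    self-map of the finite set of nodes; any periodic orbit of it is a loop.
    Distinct nodes of the orbit have distinct chosen branches, since a branch
    leaves only one node. *)
Lemma loop_in_support i b0 : (forall v, outflow i v = 0) -> i b0 != 0 ->
  exists2 s, loop s & all (fun p : node N * branch N => i p.2 != 0) s.
Proof.
move=> flow0 ib0.
pose out v := odflt b0 [pick b | (i b != 0) && (upstream i b == v)].
pose f v := downstream i (out v).
have i_out v : i (out v) != 0 by rewrite /out; case: pickP => [b /andP[]|].
have stream_out b :
    i b != 0 -> upstream i (out (downstream i b)) = downstream i b.
  move=> /(next_branch flow0)[b' ib' tb']; rewrite /out.
  by case: pickP => [c /andP[_ /eqP]//|/(_ b')]; rewrite ib' tb' eqxx.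
have [v [tv cyc]] : exists v,
    (forall m, upstream i (out (iter m f v)) = iter m f v) /\
    fcycle f (orbit f v).
  have /trajectP[m lt_m eq_m] := looping_order f (downstream i b0).
  exists (iter m f (downstream i b0)); split=> [k|].
    by rewrite -iterD; case: (k + m)%N => [|l] /=; apply: stream_out.
  (* The iterates numbered m and order f _ coincide, so iterate m is periodic
     with their difference as a period; the view asks for a period k.+1. *)
  apply/(orbitPcycle 0 3); exists (order f (downstream i b0) - m).-1.
  rewrite prednK ?subn_gt0 // -iterD subnK //; exact: ltnW.
exists [seq (u, out u) | u <- orbit f v]; last first.
  by apply/allP => p /mapP[u _ ->] /=.
have stream_orbit u : u \in orbit f v -> upstream i (out u) = u.
  by move=> /trajectP[m _ ->].
apply/and4P; split.
- by rewrite /orbit -orderSpred.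
- by rewrite -map_comp map_id_in // orbit_uniq.
- rewrite -map_comp map_inj_in_uniq ?orbit_uniq // => u w uo wo /= eq_out.
  by rewrite -(stream_orbit u uo) -(stream_orbit w wo) eq_out.
- have sub : {in orbit f v &, forall u w, frel f u w ->
      joins (out u) u w}.
    move=> u w uo _ /= /eqP <-; rewrite -{2}(stream_orbit u uo).
    exact: joins_stream.
  rewrite cycle_map; apply: (sub_in_cycle (P := mem (orbit f v))) cyc => //.
Qed.

(** The unit current circulating along [s]: a branch counts positively when
    [s] leaves it through its source. *)
Definition loop_flow (s : seq (node N * branch N)) b : R :=
  \sum_(p <- s | p.2 == b) (if source b == p.1 then 1 else -1).

Lemma loop_flow_neq0 s b : loop s -> (loop_flow s b != 0) = (b \in map snd s).
Proof.
case/and4P=> _ _ us _; apply/idP/idP => [|/mapP[p ps ->]].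
  apply: contraR => bs; rewrite /loop_flow big_seq_cond big1 //.
  by move=> p /andP[ps /eqP pb]; case/mapP: bs; exists p.
rewrite /loop_flow -big_filter.
suff -> : [seq q <- s | q.2 == p.2] = [:: p].
  by rewrite big_seq1; case: ifP; rewrite ?oppr_eq0 oner_eq0.
have inj := map_uniq us.
elim: s ps us {inj} => //= q s IHs; rewrite inE => /predU1P[<-|ps] /andP[qs us].
  rewrite eqxx; congr cons; apply/eqP; rewrite -(negbK (_ == _)) -has_filter.
  by apply: contra qs => /hasP[r rs /eqP <-]; apply: map_f.
rewrite IHs //; case: eqP => // qp; case/negP: qs; rewrite qp; exact: map_f.
Qed.

(** Each step of the loop contributes the indicator of the node that it leaves
    minus that of the node that it enters; around the cycle these telescope. *)
Lemma outflow_loop_flow s v : loop s -> outflow (loop_flow s) v = 0.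
Proof.
case/and4P=> s0 _ _ cyc.
have -> : outflow (loop_flow s) v = \sum_(p <- s)
    (if source p.2 == p.1 then 1 else -1) *
    ((source p.2 == v)%:R - (target p.2 == v)%:R).
  rewrite /outflow /loop_flow.
  under eq_bigr do rewrite mulr_suml big_mkcond.
  rewrite exchange_big /=; apply: eq_bigr => p _.
  by rewrite -big_mkcond /= (big_pred1 p.2) // => b; rewrite eq_sym.
have step (p q : node N * branch N) : joins p.2 p.1 q.1 ->
    (if source p.2 == p.1 then 1 else -1) *
    ((source p.2 == v)%:R - (target p.2 == v)%:R) =
    (p.1 == v)%:R - (q.1 == v)%:R :> R.
  rewrite /joins; case: (eqVneq (source p.2) p.1) => [->|_] /=.
    rewrite mul1r; case/orP=> [/eqP->|/andP[/eqP-> /eqP->]] //.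
  by case/andP=> /eqP-> /eqP->; rewrite mulN1r opprB.
case: s s0 cyc => // p s _ /=.
set F := BIG_F.
suff tele q : path (fun p q => joins p.2 p.1 q.1) q (rcons s p) ->
    \sum_(r <- q :: s) F r = (q.1 == v)%:R - (p.1 == v)%:R :> R.
  by move=> /tele ->; rewrite subrr.
elim: s q => [|r s IHs] q /= /andP[qr].
  by move=> _; rewrite big_seq1 /F (step _ _ qr).
by move=> /IHs; rewrite big_cons => ->; rewrite /F (step _ _ qr) subrKA.
Qed.

Definition adjacent S : rel (node N) := fun u v => [exists b in S, joins b u v].

Lemma connected_byP S :
  reflect (forall u v, connect (adjacent S) u v) (connected_by S).
Proof.
apply: (iffP forallP) => c u; first exact/forallP/c.
by apply/forallP => v; apply: c.
Qed.

Lemma adjacent_branch S b : b \in S -> adjacent S (source b) (target b).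
Proof. by move=> bS; apply/exists_inP; exists b; rewrite // /joins !eqxx. Qed.

Lemma connected_potential S E : connected_by S ->
  {in S, forall b, E (source b) = E (target b)} -> forall u v, E u = E v.
Proof.
move=> /connected_byP conn ES u v; have /connectP[p pth ->] := conn u v.
elim: p u pth => //= w p IHp u /andP[/exists_inP[b bS j] pth].
rewrite -(IHp w pth); have := ES b bS.
by case/orP: j => /andP[/eqP-> /eqP->].
Qed.

(** The indicator of the nodes that [S] does not connect to the reference
    node. *)
Lemma disconnected_potential S : ~~ connected_by S ->
  exists E, [/\ E (refnode N) = 0, exists v, E v != 0 &
    {in S, forall b, E (source b) = E (target b)}].
Proof.
move=> disc; have sym : connect_sym (adjacent S).
  apply: sym_connect_sym => u v.
  by apply: eq_existsb => b; rewrite /joins orbC.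
exists (fun v => (~~ connect (adjacent S) (refnode N) v)%:R); split.
- by rewrite connect0.
- have /existsP[v nv] : [exists v, ~~ connect (adjacent S) (refnode N) v].
    rewrite -negb_forall; apply: contra disc => /forallP c.
    by apply/connected_byP => u v; rewrite (connect_trans _ (c v)) // sym.
  by exists v; rewrite nv oner_eq0.
- move=> b bS; congr (~~ _)%:R; apply: same_connect_r => //; apply: connect1.
  exact: adjacent_branch.
Qed.

Lemma connected_byS S S' : S \subset S' -> connected_by S -> connected_by S'.
Proof.
move=> /fintype.subsetP sub /connected_byP c; apply/connected_byP => u v.
apply: connect_sub (c u v) => w w' /exists_inP[b bS j].
by apply/connect1/exists_inP; exists b; rewrite ?sub.
Qed.

(** A superset of a disconnecting set is disconnecting, and every disconnecting
    set contains a minimal one. *)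
Lemma cutset_in S :
  (exists2 K, cutset K & K \subset S) <-> ~~ connected_by (~: S).
Proof.
split=> [[K /minsetp disc sub]|disc].
  by apply: contra disc; apply: connected_byS; rewrite finset.setCS.
have [K] := minset_exists (P := fun K => ~~ connected_by (~: K)) disc.
by exists K.
Qed.

Definition branch_current (i : forall k, 'cV[R]_(nb N k)) b : R :=
  i (tag b) (tagged b) 0.

(** The potential of the grounded reference node is zero. *)
Definition node_potential (e : 'cV[R]_(nn N)) v : R :=
  oapp (fun k => e k 0) 0 (unlift (refnode N) v).

Lemma sum_incidence (i : forall k, 'cV[R]_(nb N k)) k :
  (\sum_d incidence N R d *m i d) k 0 =
  outflow (branch_current i) (lift (refnode N) k).
Proof.
rewrite summxE /outflow.
under eq_bigr do rewrite mxE.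
rewrite sig_big_dep /=; apply: eq_bigr => -[d j] _ /=.
by rewrite mxE /branch_current mulrC.
Qed.

Lemma incidenceT d (e : 'cV[R]_(nn N)) j :
  ((incidence N R d)^T *m e) j 0 =
  let b : branch N := Tagged (fun k' : device => 'I_(nb N k')) j in
  node_potential e (source b) - node_potential e (target b).
Proof.
rewrite mxE /=; set b := Tagged _ _.
have potE u : \sum_k (u == lift (refnode N) k)%:R * e k 0 = node_potential e u.
  rewrite /node_potential; case: unliftP => [k ->|->] /=.
    rewrite (bigD1 k) //= eqxx mul1r big1 ?addr0 // => l /negPf lk.
    by rewrite (inj_eq lift_inj) eq_sym lk mul0r.
  by rewrite big1 // => k _; rewrite (negPf (neq_lift _ _)) mul0r.
rewrite -!potE -sumrB; apply: eq_bigr => k _.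
by rewrite !mxE mulrBl.
Qed.

(** The columns of the incidence matrix of the branches with type in [P] are
    linearly independent exactly when these branches form a forest. *)
Lemma no_loop_incidence P :
  (forall s, loop s -> ~~ all (fun p : node N * branch N => P (tag p.2)) s) <->
  (forall i : forall k, 'cV[R]_(nb N k), (forall k, ~~ P k -> i k = 0) ->
    \sum_k incidence N R k *m i k = 0 -> forall k, i k = 0).
Proof.
split=> [noloop i iP Ai k|inj s ls].
  apply/colP => j; rewrite [RHS]mxE; apply/eqP/negPn/negP => ij.
  have flow0 : forall v, outflow (branch_current i) v = 0.
    by apply: outflow_refnode => l; rewrite -sum_incidence Ai mxE.
  have [s ls /allP supp] :=
    loop_in_support (b0 := Tagged (fun k' : device => 'I_(nb N k')) j) flow0 ij.
  case/negP: (noloop s ls); apply/allP => p /supp.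
  by apply: contraR => /iP; rewrite /branch_current => ->; rewrite mxE.
apply/negP => /allP sP.
pose i k : 'cV[R]_(nb N k) :=
  \col_j loop_flow s (Tagged (fun k' : device => 'I_(nb N k')) j).
have iE : branch_current i =1 loop_flow s.
  by case=> k j; rewrite /branch_current mxE.
have in_s b : i (tag b) (tagged b) 0 != 0 -> exists2 p, p \in s & p.2 = b.
  rewrite -/(branch_current i b) iE loop_flow_neq0 // => /mapP[p ps ->].
  by exists p.
have i0 : forall k, i k = 0.
  apply: inj => [k nP|].
    apply/colP => j; rewrite [RHS]mxE; apply/eqP/negPn/negP.
    move/(in_s (Tagged (fun k' : device => 'I_(nb N k')) j)) => [p /sP pP pj].
    by case/negP: nP; move: pP; rewrite pj.
  apply/colP => k; rewrite sum_incidence mxE.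
  rewrite -(outflow_loop_flow (lift (refnode N) k) ls).
  by apply: eq_bigr => b _; rewrite iE.
have : s != [::] by case/and4P: ls.
rewrite -size_eq0 -lt0n -has_predT => /hasP[p ps _].
have := loop_flow_neq0 p.2 ls; rewrite -iE /branch_current i0 mxE eqxx.
by rewrite map_f.
Qed.

(** The rows of the incidence matrix of the branches with type outside [P] are
    linearly independent exactly when these branches connect all nodes. *)
Lemma no_cutset_incidence P :
  (forall K, cutset K -> ~~ [forall b in K, P (tag b)]) <->
  (forall e : 'cV[R]_(nn N),
    (forall k, ~~ P k -> (incidence N R k)^T *m e = 0) -> e = 0).
Proof.
pose S : {set branch N} := [set b | P (tag b)].
have forallE K : [forall b in K, P (tag b)] = (K \subset S).
  by apply/forall_inP/fintype.subsetP => h b /h; rewrite inE.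
have -> : (forall K, cutset K -> ~~ [forall b in K, P (tag b)]) <->
    connected_by (~: S).
  split=> [nocut|conn K cK].
    apply/negPn/negP => /cutset_in[K cK]; rewrite -forallE.
    exact/negP/nocut.
  rewrite forallE; apply/negP => KS; move: conn.
  by apply/negP/cutset_in; exists K.
split=> [conn e eP|inj].
  have eS : {in ~: S, forall b,
      node_potential e (source b) = node_potential e (target b)}.
    case=> k j; rewrite !inE /= => nP; apply/eqP; rewrite -subr_eq0.
    by have := incidenceT e j; rewrite /= => <-; rewrite eP // mxE.
  have := connected_potential conn eS; rewrite /node_potential => cst.
  apply/colP => k; have := cst (lift (refnode N) k) (refnode N).
  by rewrite liftK unlift_none mxE.
apply/negPn/negP => /disconnected_potential[E [E0 [v Ev] ES]].
pose e : 'cV[R]_(nn N) := \col_k E (lift (refnode N) k).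
have eE : node_potential e =1 E.
  move=> u; rewrite /node_potential.
  by case: unliftP => [k ->|->] //=; rewrite mxE.
have e0 : e = 0.
  apply: inj => k nP; apply/colP => j; rewrite incidenceT /= !eE mxE.
  by rewrite ES ?subrr // !inE.
case/negP: Ev; rewrite -eE e0 /node_potential.
by case: unlift => //= k; rewrite mxE.
Qed.

End Graph.

(** * Power *)

Section Power.
Variable R : realType.

Definition dot n (u v : 'cV[R]_n) : R := (u^T *m v) 0 0.

Lemma dot0l n (v : 'cV[R]_n) : dot 0 v = 0.
Proof. by rewrite /dot trmx0 mul0mx mxE. Qed.

Lemma dot0r n (u : 'cV[R]_n) : dot u 0 = 0.
Proof. by rewrite /dot mulmx0 mxE. Qed.

Lemma dotC n (u v : 'cV[R]_n) : dot u v = dot v u.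
Proof. by rewrite /dot -[u in RHS]trmxK -trmx_mul [RHS]mxE. Qed.

Lemma posdef_dot_ge0 n (K : 'M[R]_n) u : posdef K -> 0 <= dot u (K *m u).
Proof.
move=> pK; have [->|u0] := eqVneq u 0; first by rewrite dot0l.
by rewrite /dot mulmxA ltW // pK.
Qed.

Lemma posdef_dot_eq0 n (K : 'M[R]_n) u :
  posdef K -> dot u (K *m u) = 0 -> u = 0.
Proof.
move=> pK; rewrite /dot mulmxA => Ku0; apply/eqP/negPn/negP => /pK.
by rewrite Ku0 ltxx.
Qed.

(** The total power is the pairing of [e] with the left-hand side of Kirchhoff's
    current law. *)
Lemma tellegen (N : digraph) (e : 'cV[R]_(nn N))
    (i : forall k, 'cV[R]_(nb N k)) :
  \sum_k incidence N R k *m i k = 0 ->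
  \sum_k dot ((incidence N R k)^T *m e) (i k) = 0.
Proof.
move=> Ai; rewrite -[RHS](dot0r e) -Ai /dot mulmx_sumr summxE.
by apply: eq_bigr => k _; rewrite trmx_mul trmxK mulmxA.
Qed.

End Power.

Lemma sum_device (V : zmodType) (F : device -> V) :
  \sum_k F k = F kc + F kmc + F ku + F kl + F kml + F kg + F kw + F kr + F km
               + F khm + F khw + F kj.
Proof.
rewrite (bigD1 kc) // (bigD1 kmc) // (bigD1 ku) // (bigD1 kl) // (bigD1 kml) //.
rewrite (bigD1 kg) // (bigD1 kw) // (bigD1 kr) // (bigD1 km) // (bigD1 khm) //.
rewrite (bigD1 khw) // (bigD1 kj) //= big_pred0 => [|[] //].
by rewrite addr0 !addrA.
Qed.

(** * The linearized nodal equations *)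

Section Linearization.
Variables (R : realType) (N : circuit R).
Local Notation n k := (nb N k).
Local Notation A k := (incidence N R k).
Variables (Cc : 'M[R]_(n kc)) (Cm : 'M[R]_(n kmc)).
Variables (Ll : 'M[R]_(n kl)) (Lm : 'M[R]_(n kml)).
Variables (Rr : 'M[R]_(n kr)) (Gg : 'M[R]_(n kg)).
Variables (Mm : 'M[R]_(n km)) (Mh : 'M[R]_(n khm)).
Variables (Ww : 'M[R]_(n kw)) (Wh : 'M[R]_(n khw)).

Definition pack e i_c i_mc i_u i_l i_ml i_r i_m i_hm i_hw : 'cV[R]_(dim_y N) :=
  col_mx e (col_mx i_c (col_mx i_mc (col_mx i_u (col_mx i_l (col_mx i_ml
    (col_mx i_r (col_mx i_m (col_mx i_hm i_hw)))))))).

Definition linearized_g (y : 'cV[R]_(dim_y N)) : 'cV[R]_(dim_y N) :=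
  let e := usubmx y in      let y1 := dsubmx y in
  let i_c := usubmx y1 in   let y2 := dsubmx y1 in
  let i_mc := usubmx y2 in  let y3 := dsubmx y2 in
  let i_u := usubmx y3 in   let y4 := dsubmx y3 in
  let i_l := usubmx y4 in   let y5 := dsubmx y4 in
  let i_ml := usubmx y5 in  let y6 := dsubmx y5 in
  let i_r := usubmx y6 in   let y7 := dsubmx y6 in
  let i_m := usubmx y7 in   let y8 := dsubmx y7 in
  let i_hm := usubmx y8 in  let i_hw := dsubmx y8 in
  pack (A kc *m i_c + A kmc *m i_mc + A ku *m i_u + A kl *m i_l
        + A kml *m i_ml + A kg *m (Gg *m ((A kg)^T *m e))
        + A kw *m (Ww *m ((A kw)^T *m e)) + A kr *m i_r
        + A km *m i_m + A khm *m i_hm + A khw *m i_hw)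
    (- (Cc *m ((A kc)^T *m e)))
    (- (Cm *m ((A kmc)^T *m e)))
    (- ((A ku)^T *m e))
    (- (Ll *m i_l))
    (- (Lm *m i_ml))
    (Rr *m i_r - (A kr)^T *m e)
    (Mm *m i_m - (A km)^T *m e)
    (Mh *m i_hm - (A khm)^T *m e)
    (i_hw - Wh *m ((A khw)^T *m e)).

Lemma pack_eta (y : 'cV[R]_(dim_y N)) :
  exists e i_c i_mc i_u i_l i_ml i_r i_m i_hm i_hw,
    y = pack e i_c i_mc i_u i_l i_ml i_r i_m i_hm i_hw.
Proof.
have split m p (z : 'cV[R]_(m + p)) : exists a b, z = col_mx a b.
  by exists (usubmx z), (dsubmx z); rewrite vsubmxK.
have [e [y1 ->]] := split _ _ y; have [i_c [y2 ->]] := split _ _ y1.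
have [i_mc [y3 ->]] := split _ _ y2; have [i_u [y4 ->]] := split _ _ y3.
have [i_l [y5 ->]] := split _ _ y4; have [i_ml [y6 ->]] := split _ _ y5.
have [i_r [y7 ->]] := split _ _ y6; have [i_m [y8 ->]] := split _ _ y7.
have [i_hm [i_hw ->]] := split _ _ y8.
by exists e, i_c, i_mc, i_u, i_l, i_ml, i_r, i_m, i_hm, i_hw.
Qed.

Lemma pack_eq0 e i_c i_mc i_u i_l i_ml i_r i_m i_hm i_hw :
  pack e i_c i_mc i_u i_l i_ml i_r i_m i_hm i_hw = 0 <->
  [/\ e = 0, i_c = 0, i_mc = 0 & i_u = 0] /\
  [/\ i_l = 0, i_ml = 0, i_r = 0 & i_m = 0] /\ i_hm = 0 /\ i_hw = 0.
Proof.
split=> [/eqP|].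
  by rewrite !col_mx_eq0 => /and5P[/eqP-> /eqP-> /eqP-> /eqP->
    /and5P[/eqP-> /eqP-> /eqP-> /eqP-> /andP[/eqP-> /eqP->]]].
by case=> [[-> -> -> ->] [[-> -> -> ->] [-> ->]]]; rewrite /pack !col_mx0.
Qed.

(** Voltage-controlled resistors and [w]-memristors have no current unknown:
    their currents are expressed through the potentials.  The current sources
    contribute a constant, hence zero after linearization. *)
Definition currents e i_c i_mc i_u i_l i_ml i_r i_m i_hm i_hw k :
    'cV[R]_(n k) :=
  match k with
  | kc => i_c | kmc => i_mc | ku => i_u | kl => i_l | kml => i_ml
  | kg => Gg *m ((A kg)^T *m e) | kw => Ww *m ((A kw)^T *m e)
  | kr => i_r | km => i_m | khm => i_hm | khw => i_hw | kj => 0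
  end.

Hypotheses (Cc_unit : Cc \in unitmx) (Cm_unit : Cm \in unitmx).
Hypotheses (Ll_unit : Ll \in unitmx) (Lm_unit : Lm \in unitmx).
Hypotheses (Rr_posdef : posdef Rr) (Gg_posdef : posdef Gg).
Hypotheses (Mm_posdef : posdef Mm) (Mh_posdef : posdef Mh).
Hypotheses (Ww_posdef : posdef Ww) (Wh_posdef : posdef Wh).

(** By Tellegen's theorem the power dissipated in the positive definite devices
    is the power that the other branches supply, and these supply none because
    their voltage or their current vanishes. *)
Lemma linearized_g_eq0 e i_c i_mc i_u i_l i_ml i_r i_m i_hm i_hw :
  let i := currents e i_c i_mc i_u i_l i_ml i_r i_m i_hm i_hw in
  linearized_g (pack e i_c i_mc i_u i_l i_ml i_r i_m i_hm i_hw) = 0 <->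
  [/\ \sum_k A k *m i k = 0,
      forall k, k \notin [:: kj; kl; kml] -> (A k)^T *m e = 0 &
      forall k, k \notin [:: ku; kc; kmc] -> i k = 0].
Proof.
move=> i; rewrite /linearized_g /pack !(col_mxKu, col_mxKd).
rewrite -/(pack _ _ _ _ _ _ _ _ _ _).
rewrite pack_eq0; split=> [|[kcl Ae0 i0]]; last first.
  have := i0 kl isT; have := i0 kml isT; have := i0 kr isT; have := i0 km isT.
  have := i0 khm isT; have := i0 khw isT; rewrite /= => hw hm m r ml l.
  rewrite sum_device /= mulmx0 addr0 in kcl.
  rewrite kcl !Ae0 // l ml r m hm hw.
  by rewrite !mulmx0 !subrr !oppr0; do !split.
case=> -[kcl /eqP + /eqP + /eqP].
rewrite !oppr_eq0 => /eqP/(proj1 (unitmx_kernelP _) Cc_unit) vc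
  /eqP/(proj1 (unitmx_kernelP _) Cm_unit) vmc /eqP vu.
case=> -[/eqP + /eqP].
rewrite !oppr_eq0 => /eqP/(proj1 (unitmx_kernelP _) Ll_unit) il
  /eqP/(proj1 (unitmx_kernelP _) Lm_unit) iml.
move=> /subr0_eq vr /subr0_eq vm [/subr0_eq vhm /subr0_eq vhw].
have Ai : \sum_k A k *m i k = 0 by rewrite sum_device /= mulmx0 addr0.
(* For k in c, mc, u the voltage vanishes, for k in l, ml, j the current. *)
have power_ge0 k : 0 <= dot ((A k)^T *m e) (i k).
  case: k => //=; rewrite ?vc ?vmc ?vu ?il ?iml ?dot0l ?dot0r //.
  - by rewrite -vr dotC posdef_dot_ge0.
  - exact: posdef_dot_ge0.
  - by rewrite -vm dotC posdef_dot_ge0.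
  - exact: posdef_dot_ge0.
  - by rewrite -vhm dotC posdef_dot_ge0.
  - by rewrite vhw posdef_dot_ge0.
have power0 k : dot ((A k)^T *m e) (i k) = 0.
  have /eqP := tellegen e Ai; rewrite psumr_eq0 // => /allP/(_ k).
  by rewrite mem_index_enum => /(_ isT)/eqP.
have vg : (A kg)^T *m e = 0 by apply: posdef_dot_eq0 Gg_posdef (power0 kg).
have vw : (A kw)^T *m e = 0 by apply: posdef_dot_eq0 Ww_posdef (power0 kw).
have vhw0 : (A khw)^T *m e = 0.
  by apply: posdef_dot_eq0 Wh_posdef _; rewrite -vhw (power0 khw).
have ir : i_r = 0.
  by apply: posdef_dot_eq0 Rr_posdef _; rewrite vr dotC (power0 kr).
have im : i_m = 0.
  by apply: posdef_dot_eq0 Mm_posdef _; rewrite vm dotC (power0 km).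
have ihm : i_hm = 0.
  by apply: posdef_dot_eq0 Mh_posdef _; rewrite vhm dotC (power0 khm).
split=> // [] [] //= _; rewrite ?vg ?vw ?mulmx0 //.
- by rewrite -vr ir mulmx0.
- by rewrite -vm im mulmx0.
- by rewrite -vhm ihm mulmx0.
- by rewrite vhw vhw0 mulmx0.
Qed.

(** The current part and the potential part of a solution of the linearized
    equations decouple, so each can be tested alone by setting the other to
    zero. *)
Lemma linearized_g_kernel :
  (forall y, linearized_g y = 0 -> y = 0) <-> topologically_nondegenerate N.
Proof.
have noloop := no_loop_incidence R N (fun k => k \in [:: ku; kc; kmc]).
have nocut := no_cutset_incidence R N (fun k => k \in [:: kj; kl; kml]).
rewrite /topologically_nondegenerate noloop nocut.
split=> [inj|[inj_i inj_e] y].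
  split=> [i i0 Ai|e Ae0].
    have : linearized_g (pack 0 (i kc) (i kmc) (i ku) 0 0 0 0 0 0) = 0.
      apply/linearized_g_eq0; split=> [|k _|].
      - rewrite -[RHS]Ai; apply: eq_bigr => k _; congr (_ *m _).
        by case: k => //=; rewrite ?mulmx0 ?i0.
      - exact: mulmx0.
      - by case=> //= _; rewrite !mulmx0.
    move=> /inj/pack_eq0[[_ ic imc iu] _] k.
    by case: (boolP (k \in [:: ku; kc; kmc])) => [|/i0 //]; case: k.
  have : linearized_g (pack e 0 0 0 0 0 0 0 0 0) = 0.
    have v0 : (A kg)^T *m e = 0 /\ (A kw)^T *m e = 0 by rewrite !Ae0.
    have i0 k : currents e 0 0 0 0 0 0 0 0 0 k = 0.
      by case: k => //=; rewrite (v0.1, v0.2) mulmx0.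
    apply/linearized_g_eq0; split=> //.
    by apply: big1 => k _; rewrite i0 mulmx0.
  by move=> /inj/pack_eq0[[]].
have [e [i_c [i_mc [i_u [i_l [i_ml [i_r [i_m [i_hm [i_hw ->]]]]]]]]]] :=
  pack_eta y.
move=> /linearized_g_eq0[Ai Ae0 i0]; have i_eq0 := inj_i _ i0 Ai.
apply/pack_eq0; split; [split | split; [split|split]].
- exact: inj_e.
- exact: i_eq0 kc.
- exact: i_eq0 kmc.
- exact: i_eq0 ku.
- exact: i_eq0 kl.
- exact: i_eq0 kml.
- exact: i_eq0 kr.
- exact: i_eq0 km.
- exact: i_eq0 khm.
- exact: i_eq0 khw.
Qed.

End Linearization.

(** The incremental matrices are evaluated at points read off from [x] and
    [y]; these are left unspecified because the hypotheses on the devices hold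
    at all values of their arguments. *)
Lemma is_diff_nodal_g (R : realType) (N : circuit R)
    (x : 'cV[R]_(dim_x N)) (y : 'cV[R]_(dim_y N)) t :
  exists v_c phi_mc v_mc i_l q_ml i_ml i_r v_g q_m i_m q_hm phi_hm i_hm
    phi_w v_w q_hw phi_hw v_hw,
  is_diff y (fun y' => nodal_g x y' t)
   (linearized_g (capacitance N v_c) (memcapacitance N phi_mc v_mc)
      (inductance N i_l) (meminductance N q_ml i_ml)
      (resistance N i_r) (conductance N v_g)
      (memristance N q_m i_m) (hybrid_memristance N q_hm phi_hm i_hm)
      (memductance N phi_w v_w) (hybrid_memductance N q_hw phi_hw v_hw)).
Proof.
have d0 : is_diff y (id : 'cV[R]_(dim_y N) -> _) id := is_diff_id y.
have de := is_diff_usubmx d0; have d1 := is_diff_dsubmx d0.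
have dc := is_diff_usubmx d1; have d2 := is_diff_dsubmx d1.
have dmc := is_diff_usubmx d2; have d3 := is_diff_dsubmx d2.
have du := is_diff_usubmx d3; have d4 := is_diff_dsubmx d3.
have dl := is_diff_usubmx d4; have d5 := is_diff_dsubmx d4.
have dml := is_diff_usubmx d5; have d6 := is_diff_dsubmx d5.
have dr := is_diff_usubmx d6; have d7 := is_diff_dsubmx d6.
have dm := is_diff_usubmx d7; have d8 := is_diff_dsubmx d7.
have dhm := is_diff_usubmx d8; have dhw := is_diff_dsubmx d8.
have dA k := is_diff_mulmx (incidence N R k)^T de.
do 18 eexists; rewrite /nodal_g /linearized_g /pack /=.
apply: is_diff_col_mx.
  apply: is_diff_addc.
  do ![apply: is_diff_add]; apply: is_diff_mulmx; try eassumption.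
    apply: is_diff_device (dA kg). exact: (gamma_g_C1 N).1.
  apply: is_diff_device (dA kw). exact: differentiable_C1_2 (zeta_C1 N).
apply: is_diff_col_mx.
  apply: is_diff_csub; apply: is_diff_device (dA kc). exact: (gamma_c_C1 N).1.
apply: is_diff_col_mx.
  apply: is_diff_csub; apply: is_diff_device (dA kmc).
  exact: differentiable_C1_2 (omega_C1 N).
apply: is_diff_col_mx; first exact: is_diff_csub (dA ku).
apply: is_diff_col_mx.
  apply: is_diff_csub; apply: is_diff_device dl. exact: (gamma_l_C1 N).1.
apply: is_diff_col_mx.
  apply: is_diff_csub; apply: is_diff_device dml.
  exact: differentiable_C1_2 (theta_C1 N).
apply: is_diff_col_mx.
  apply: is_diff_sub (dA kr); apply: is_diff_device dr. exact: (gamma_r_C1 N).1.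
apply: is_diff_col_mx.
  apply: is_diff_sub (dA km); apply: is_diff_device dm.
  exact: differentiable_C1_2 (eta_C1 N).
apply: is_diff_col_mx.
  apply: is_diff_sub (dA khm); apply: is_diff_device dhm.
  exact: differentiable_C1_3 (psi_C1 N).
apply: is_diff_sub dhw _; apply: is_diff_device (dA khw).
exact: differentiable_C1_3 (xi_C1 N).
Qed.

Theorem theorem1 (R : realType) (N : circuit R)
  (N_connected : connected_graph N)
  (C_nonsing : forall v, capacitance N v \in unitmx)
  (Cm_nonsing : forall phi v, memcapacitance N phi v \in unitmx)
  (L_nonsing : forall i, inductance N i \in unitmx)
  (Lm_nonsing : forall q i, meminductance N q i \in unitmx)
  (R_posdef : forall i, posdef (resistance N i))
  (G_posdef : forall v, posdef (conductance N v))
  (M_posdef : forall q i, posdef (memristance N q i))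
  (Mh_posdef : forall q phi i, posdef (hybrid_memristance N q phi i))
  (W_posdef : forall phi v, posdef (memductance N phi v))
  (Wh_posdef : forall q phi v, posdef (hybrid_memductance N q phi v))
  (x : 'cV[R]_(dim_x N)) (y : 'cV[R]_(dim_y N)) (t : R)
  (consistent : dae_g (nodal_model N) x y t = 0) :
  index_one (nodal_model N) x y t <-> topologically_nondegenerate N.
Proof.
have [v_c [phi_mc [v_mc [i_l [q_ml [i_ml [i_r [v_g [q_m [i_m [q_hm [phi_hm [i_hm
  [phi_w [v_w [q_hw [phi_hw [v_hw dg]]]]]]]]]]]]]]]]]] := is_diff_nodal_g x y t.
rewrite -(linearized_g_kernel (C_nonsing v_c) (Cm_nonsing phi_mc v_mc)
  (L_nonsing i_l) (Lm_nonsing q_ml i_ml) (R_posdef i_r) (G_posdef v_g)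
  (M_posdef q_m i_m) (Mh_posdef q_hm phi_hm i_hm) (W_posdef phi_w v_w)
  (Wh_posdef q_hw phi_hw v_hw)).
split=> [[_ /unitmx_kernelP inj] z|inj].
  by rewrite -(partials_mulmx z dg); apply: inj.
split=> //; apply/unitmx_kernelP => z.
by rewrite (partials_mulmx z dg); apply: inj.
Qed.
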